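(* Let $G=A\times B$ be a finite abelian group, where $A$ has odd order and $B$ is a non-trivial group of order a power of $2$, and suppose $2G\neq\{0\}$. Suppose that $B$ is the product of $r$ non-trivial cyclic groups, of which $q$ have order $2$, and let $k=|2G|=|G|/2^r$. Then: (1) $\Gamma^+_{G,2G}$ has clique number $k$ and independence number $2^r$; (2) $\Gamma_{G,2G}$ has clique number $(k+2^{r-q})/2$, and independence number $2^{r+1}$ unless $G$ is a product of cyclic groups of orders $2$ and $4$ only, in which case the independence number is $2^{r+1}-2^q$.
   Context: Groups are written additively with identity $0$, and $2G=\{2t: t\in G\}$. ''A product of cyclic groups of orders $2$ and $4$ only'' means a direct product of cyclic groups each of which has order $2$ or $4$. For a finite abelian group $G$ and a subgroup $H$, $\Gamma^+_{G,H}$ is the simple graph with vertex set $G$ in which distinct $x,y$ are adjacent iff $x+y\in H$; $\Gamma_{G,H}$ is the simple graph with vertex set $G$ in which distinct $x,y$ are adjacent iff $x+y\in H\setminus\{0\}$. The clique number is the maximum number of vertices in a complete subgraph, and the independence number is the maximum size of a set of pairwise non-adjacent vertices. *)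

(* Defs.v *)
From HB Require Import structures.
From mathcomp Require Import all_boot all_order all_fingroup all_algebra.
From mathcomp Require Import all_solvable.

Set Implicit Arguments.
Unset Strict Implicit.
Unset Printing Implicit Defensive.

Import GRing.Theory.
Local Open Scope ring_scope.

(* Finite simple graphs are symmetric irreflexive boolean relations. *)
Section Graphs.

Variables (T : finType) (e : rel T).

Definition clique (S : {set T}) : bool :=
  [forall x in S, forall y in S, (x != y) ==> e x y].

Definition independent (S : {set T}) : bool :=
  [forall x in S, forall y in S, (x != y) ==> ~~ e x y].

Definition clique_number : nat := (\max_(S : {set T} | clique S) #|S|)%N.

Definition independence_number : nat :=
  (\max_(S : {set T} | independent S) #|S|)%N.

End Graphs.

(* A finZmodType G is canonically a finGroupType whose group law is +%R, so
   {group G}, \x, <[x]> and #[x] below refer to the additive structure of G;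
   the neutral element 1%g is convertible to 0. *)
Section SumGraphs.

Variable G : finZmodType.

Definition sum_graph_plus (H : {group G}) : rel G :=
  fun x y => (x != y) && (x + y \in H).

Definition sum_graph (H : {group G}) : rel G :=
  fun x y => (x != y) && (x + y \in H :\ 0).

Lemma sum_graph_plus_sym (H : {group G}) : symmetric (sum_graph_plus H).
Proof. by move=> x y; rewrite /sum_graph_plus eq_sym addrC. Qed.

Lemma sum_graph_plus_irr (H : {group G}) : irreflexive (sum_graph_plus H).
Proof. by move=> x; rewrite /sum_graph_plus eqxx. Qed.

Lemma sum_graph_sym (H : {group G}) : symmetric (sum_graph H).
Proof. by move=> x y; rewrite /sum_graph eq_sym addrC. Qed.

Lemma sum_graph_irr (H : {group G}) : irreflexive (sum_graph H).
Proof. by move=> x; rewrite /sum_graph eqxx. Qed.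

Definition doubles : {set G} := [set t *+ 2 | t : G].

Lemma doubles_group_set : group_set doubles.
Proof.
apply/group_setP; split; first by apply/imsetP; exists 0; rewrite ?mul0rn.
move=> _ _ /imsetP[x _ ->] /imsetP[y _ ->].
by apply/imsetP; exists (x + y); rewrite ?mulrnDl.
Qed.

Canonical doubles_group : {group G} := Group doubles_group_set.

(* dprod is set0 when its factors are not in direct product, so for a group X
   this says that X is the internal direct product of the <[x]>, x in b. *)
Definition cyclic_decomposition (X : {set G}) (b : seq G) : Prop :=
  \big[dprod/1%g]_(x <- b) <[x]>%g = X.

Definition product_of_cyclic_2_4 : Prop :=
  exists b : seq G,
    cyclic_decomposition [set: G] b /\
    all (fun x : G => (#[x]%g == 2%N) || (#[x]%g == 4%N)) b.

End SumGraphs.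

(* Main.v *)
Require Import Defs.
From HB Require Import structures.
From mathcomp Require Import all_boot all_order all_fingroup all_algebra.
From mathcomp Require Import all_solvable.

Set Implicit Arguments.
Unset Strict Implicit.
Unset Printing Implicit Defensive.

Import GRing.Theory FinRing.Theory.
Local Open Scope ring_scope.


(** Put H = 2G.  As 2x lies in H for every x, the conditions x + y \in H and
    x - y \in H are equivalent, so both graphs only join vertices of the same
    coset of H, every coset is stable under x |-> -x, and a coset induces a
    complete graph in the first graph, and in the second one a complete graph
    minus the matching formed by the pairs {x, -x} with x <> -x.  Hence a
    coset contributes 1 to the independence number of the first graph, and to
    that of the second one it contributes 2, or 1 if it is contained in the
    2-torsion subgroup G[2]
    ([independence_number_partition], [independence_sum_graph_coset]).
    A clique of the second graph meets each pair {x, -x} with x <> -x at most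
    once; H contains the largest number of elements of G[2] among all cosets,
    and keeping one element of each pair of opposite elements of H is
    optimal ([double_clique_number_sum_graph]).

    Cosets contained in G[2] exist only if H is contained in G[2], that is if
    4G = 0, and they are then counted by the index of H in G[2]
    ([independence_number_sum_graph]).  It remains to count torsion: doubling
    has kernel G[2], so |G| = |2G| |G[2]| and |G[4]| = |2G :&: G[2]| |G[2]|,
    while G[2] and G[4] are the subgroups 'Ohm_1(B) and 'Ohm_2(B), whose
    orders are read off the cyclic decomposition of B ([card_torsion2],
    [card_doubles_torsion2]).  Finally 4G = 0 holds precisely when G is a
    product of cyclic groups of orders 2 and 4, because it forces the odd
    part A to be trivial ([product_of_cyclic_2_4_torsion]). *)

(** * Maxima over cliques and independent sets *)

Lemma bigmax_card_eq (T : finType) (Q : pred {set T}) (S : {set T}) :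
  Q S -> (forall S', Q S' -> (#|S'| <= #|S|)%N) ->
  \max_(S' : {set T} | Q S') #|S'| = #|S|.
Proof.
move=> QS maxS; apply/eqP; rewrite eqn_leq; apply/andP; split.
  by apply/bigmax_leqP=> S'; apply: maxS.
exact: (leq_bigmax_cond (F := fun S' : {set T} => #|S'|)).
Qed.

Section GraphParts.

Variables (T : finType) (e : rel T).

Lemma cliqueP (S : {set T}) :
  reflect {in S &, forall x y, x != y -> e x y} (clique e S).
Proof.
apply: (iffP 'forall_in_'forall_in_implyP) => eS x; first by move=> y /eS; apply.
by move=> xS y; apply: eS.
Qed.

Lemma independentP (S : {set T}) :
  reflect {in S &, forall x y, x != y -> ~~ e x y} (independent e S).
Proof.
apply: (iffP 'forall_in_'forall_in_implyP) => eS x; first by move=> y /eS; apply.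
by move=> xS y; apply: eS.
Qed.

Lemma independent0 : independent e set0.
Proof. by apply/independentP=> x y; rewrite inE. Qed.

Lemma independent1 x : independent e [set x].
Proof. by apply/independentP=> y z /set1P-> /set1P->; rewrite eqxx. Qed.

(** The independence number of the subgraph induced on C. *)
Definition independence_in (C : {set T}) : nat :=
  (\max_(S : {set T} | independent e S && (S \subset C)) #|S|)%N.

Lemma card_sum_partition (P : {set {set T}}) (S : {set T}) :
  partition P [set: T] -> #|S| = (\sum_(C in P) #|S :&: C|)%N.
Proof.
case/and3P=> /eqP covP trivP _.
rewrite -sum1_card big_mkcond /=.
have := @big_trivIset T nat 0%N addn P (fun x => if x \in S then 1%N else 0%N) trivP.
rewrite covP (eq_bigl predT) => [->|x]; last by rewrite inE.
apply: eq_bigr => C _; rewrite -sum1_card -big_mkcondr /=.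
by apply: eq_bigl => x; rewrite inE andbC.
Qed.

Lemma independence_number_partition (P : {set {set T}}) :
    partition P [set: T] ->
    (forall x y, e x y -> pblock P x = pblock P y) ->
  independence_number e = (\sum_(C in P) independence_in C)%N.
Proof.
move=> partP eP; have [_ trivP _] := and3P partP.
pose Q (C S : {set T}) := independent e S && (S \subset C).
pose f C := [arg max_(S > set0 | Q C S) #|S|].
have Q0 C : Q C set0 by rewrite /Q independent0 sub0set.
have fP C : Q C (f C) /\ independence_in C = #|f C|.
  rewrite /f; case: arg_maxnP => // S QS maxS; split=> //.
  exact: bigmax_card_eq.
have fI C : C \in P -> (\bigcup_(D in P) f D) :&: C = f C.
  move=> PC; have [/andP[_ sfC] _] := fP C.
  apply/eqP; rewrite eqEsubset subsetI sfC (bigcup_sup C) // !andbT.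
  apply/subsetP=> x /setIP[/bigcupP[D PD fDx] Cx].
  have [/andP[_ /subsetP sfD] _] := fP D.
  by rewrite -(def_pblock trivP PC Cx) (def_pblock trivP PD (sfD x fDx)).
rewrite (eq_bigr (fun C => #|(\bigcup_(D in P) f D) :&: C|)) => [|C PC].
  rewrite -card_sum_partition //; apply: bigmax_card_eq => [|S indS].
    apply/independentP=> x y /bigcupP[C PC fCx] /bigcupP[D PD fDy] neq_xy.
    have [/andP[/independentP indC /subsetP sfC] _] := fP C.
    have [/andP[_ /subsetP sfD] _] := fP D.
    apply/negP=> exy; have := eP x y exy.
    rewrite (def_pblock trivP PC (sfC x fCx)).
    rewrite (def_pblock trivP PD (sfD y fDy)) => defD.
    have fCy : y \in f C by rewrite defD.
    by have := indC x y fCx fCy neq_xy; rewrite exy.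
  rewrite (card_sum_partition _ partP) [leqRHS](card_sum_partition _ partP).
  apply: leq_sum => C PC; rewrite fI // -(proj2 (fP C)).
  apply: (leq_bigmax_cond (F := fun S' : {set T} => #|S'|)).
  rewrite subsetIr andbT; apply/independentP=> x y /setIP[Sx _] /setIP[Sy _].
  exact: (independentP _ indS).
by rewrite fI //; case: (fP C).
Qed.

End GraphParts.

(** * Doubling and torsion *)

Section Torsion.

Variable G : finZmodType.

(** The subgroup G[n] of the elements killed by n. *)
Definition torsion (n : nat) : {set G} := [set x | x *+ n == 0].

Lemma torsion_group_set n : group_set (torsion n).
Proof.
apply/group_setP; split=> [|x y]; first by rewrite inE zmod1gE mul0rn.
by rewrite !inE zmodMgE mulrnDl => /eqP-> /eqP->; rewrite addr0.
Qed.

Canonical torsion_group n : {group G} := Group (torsion_group_set n).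

Lemma torsion2P x : reflect (x = - x) (x \in torsion 2).
Proof. by rewrite inE mulr2n addr_eq0; apply: eqP. Qed.

Lemma torsion2_sub_torsion4 : torsion 2 \subset torsion 4.
Proof.
by apply/subsetP=> x; rewrite !inE (mulrnA x 2 2) => /eqP->; rewrite mul0rn.
Qed.

Lemma doubles_sub_torsion2 : (doubles G \subset torsion 2) = (torsion 4 == setT).
Proof.
apply/subsetP/eqP=> [sD | t4 _ /imsetP[x _ ->]].
  apply/setP=> x; rewrite !inE (mulrnA x 2 2).
  by have := sD (x *+ 2) (imset_f _ _); rewrite !inE => ->.
by have := in_setT x; rewrite -t4 !inE (mulrnA x 2 2).
Qed.

Lemma mem_double x : x *+ 2 \in doubles G.
Proof. exact: imset_f. Qed.

(** Doubling, as an endomorphism of G with kernel G[2]. *)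
Definition double (x : G) : G := x *+ 2.

Lemma doubleM : {in [set: G] &, {morph double : x y / (x * y)%g}}.
Proof. by move=> x y _ _; rewrite /double !zmodMgE mulrnDl. Qed.

Canonical double_morphism := Morphism doubleM.

Lemma ker_double : ('ker double)%g = torsion 2.
Proof. by apply/setP=> x; rewrite !inE. Qed.

Lemma card_double_imset (K : {group G}) :
  torsion 2 \subset K -> (#|double @: K| * #|torsion 2|)%N = #|K|.
Proof.
move=> sK; rewrite -morphimEsub ?subsetT // card_morphim setTI ker_double.
by rewrite mulnC Lagrange.
Qed.

Lemma card_doubles : (#|doubles G| * #|torsion 2|)%N = #|G|.
Proof.
rewrite -cardsT -(@card_double_imset [group of [set: G]]) ?subsetT //.
congr (_ * _)%N; apply: eq_card => x.
by apply/imsetP/imsetP=> [] [y _ ->]; exists y; rewrite ?inE.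
Qed.

(** Doubling maps G[4] onto the intersection of 2G with G[2]. *)
Lemma card_doublesI :
  (#|doubles G :&: torsion 2| * #|torsion 2|)%N = #|torsion 4|.
Proof.
rewrite -(card_double_imset torsion2_sub_torsion4); congr (_ * _)%N.
apply: eq_card => x; apply/setIP/imsetP=> [[/imsetP[y _ ->]] | [y ty ->]].
  by rewrite inE -mulrnA => ty; exists y; rewrite ?inE.
by split; [apply: mem_double | rewrite !inE -mulrnA in ty *].
Qed.

End Torsion.

(** * The sum graphs attached to 2G *)

Section SumGraphsOfDoubles.

Variable G : finZmodType.

Let H := doubles_group G.
Let P := rcosets H [set: G].

Lemma mem_rcoset_doubles (x y : G) : (x \in (H :* y)%g) = (x + y \in H).
Proof.
rewrite mem_rcoset -(groupMr (x * y^-1)%g (mem_double y : _ \in H)).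
by rewrite !zmodMgE zmodVgE mulr2n addrA subrK.
Qed.

Lemma rcosets_doubles_partition : partition P [set: G].
Proof. exact: rcosets_partition (subsetT _). Qed.

Lemma pblock_rcosets_doubles x : pblock P x = (H :* x)%g.
Proof.
have [_ trivP _] := and3P rcosets_doubles_partition.
apply: (def_pblock trivP _ (rcoset_refl H x)).
by apply/rcosetsP; exists x; rewrite ?inE.
Qed.

Lemma pblock_doubles_eq x y : x + y \in H -> pblock P x = pblock P y.
Proof.
by rewrite -mem_rcoset_doubles !pblock_rcosets_doubles => /rcoset_eqP.
Qed.

Lemma card_rcosets_doubles : #|P| = #|torsion G 2|.
Proof.
have sHT : H \subset [group of [set: G]] := subsetT _.
have := Lagrange sHT; rewrite cardsT -card_doubles => /eqP.
by rewrite eqn_pmul2l ?cardG_gt0 // => /eqP.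
Qed.

Lemma oppr_rcoset_doubles (x y : G) : (- x \in (H :* y)%g) = (x \in (H :* y)%g).
Proof.
rewrite !mem_rcoset_doubles -(groupMr (- x + y) (mem_double x : _ \in H)).
by rewrite zmodMgE mulr2n addrCA addrA addNKr addrC.
Qed.

Lemma rcoset_doublesD (x y z : G) :
  x \in (H :* z)%g -> y \in (H :* z)%g -> x + y \in H.
Proof.
by move=> + /rcoset_eqP zy; rewrite -zy mem_rcoset_doubles.
Qed.

Lemma clique_number_sum_graph_plus :
  clique_number (sum_graph_plus H) = #|doubles G|.
Proof.
apply: bigmax_card_eq => [|S /cliqueP cliS].
  by apply/cliqueP=> x y Hx Hy neq_xy; rewrite /sum_graph_plus neq_xy (groupM Hx Hy).
have [->|[x Sx]] := set_0Vmem S; first by rewrite cards0.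
rewrite -(card_rcoset H x); apply/subset_leq_card/subsetP=> y Sy.
have [->|neq_yx] := eqVneq y x; first exact: rcoset_refl.
by rewrite mem_rcoset_doubles; case/andP: (cliS y x Sy Sx neq_yx).
Qed.

Lemma independence_number_sum_graph_plus :
  independence_number (sum_graph_plus H) = #|torsion G 2|.
Proof.
rewrite (independence_number_partition rcosets_doubles_partition); last first.
  by move=> x y /andP[_]; apply: pblock_doubles_eq.
rewrite -card_rcosets_doubles -sum1_card; apply: eq_bigr => _ /rcosetsP[c _ ->].
rewrite -(cards1 c); apply: bigmax_card_eq => [|S].
  by rewrite independent1 sub1set rcoset_refl.
case/andP=> /independentP indS /subsetP sS; rewrite cards1.
apply/card_le1_eqP=> y x Sy Sx; apply/eqP/negPn/negP=> neq_xy.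
have := indS x y Sx Sy neq_xy; rewrite /sum_graph_plus neq_xy.
by rewrite (rcoset_doublesD (sS x Sx) (sS y Sy)).
Qed.

(** A coset of 2G meets the 2-torsion in at most as many elements as 2G. *)
Lemma card_rcosetI_torsion2 (z : G) :
  (#|(H :* z)%g :&: torsion G 2| <= #|doubles G :&: torsion G 2|)%N.
Proof.
have [->|[c /setIP[Cc tc]]] := set_0Vmem ((H :* z)%g :&: torsion G 2).
  by rewrite cards0.
rewrite -(card_rcoset (doubles G :&: torsion G 2) c).
apply/subset_leq_card/subsetP=> x /setIP[Cx tx].
rewrite mem_rcoset inE (groupM tx (groupVr tc)) andbT -mem_rcoset.
by rewrite (mem_rcoset_doubles x c) (rcoset_doublesD Cx Cc).
Qed.

Lemma double_clique_number_sum_graph :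
  (2 * clique_number (sum_graph H))%N
    = (#|doubles G| + #|doubles G :&: torsion G 2|)%N.
Proof.
(* The clique keeps one element of each pair {x, -x}: the one which comes
   first in the enumeration of G. *)
pose S := [set x in H | (enum_rank x <= enum_rank (- x)%R)%N].
have cardN (X : {set G}) : #|-%R @: X| = #|X| := card_imset _ oppr_inj.
have NI (X : {set G}) x : (x \in -%R @: X) = (- x \in X).
  by rewrite -{1}[x]opprK mem_imset //; apply: oppr_inj.
have cliS : clique (sum_graph H) S.
  apply/cliqueP=> x y; rewrite !inE => /andP[Hx lex] /andP[Hy ley] neq_xy.
  rewrite /sum_graph neq_xy !inE /= (groupM Hx Hy) andbT.
  apply: contraNneq neq_xy => /eqP; rewrite addr_eq0 => /eqP defx.
  move: lex; rewrite defx opprK => lex; apply/eqP.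
  by apply/enum_rank_inj/val_inj/eqP; rewrite /= eqn_leq; apply/andP; split.
have cardS : (2 * #|S|)%N = (#|doubles G| + #|doubles G :&: torsion G 2|)%N.
  rewrite mul2n -addnn -{2}(cardN S) -(cardsUI S); congr (_ + _)%N.
    apply: eq_card => x; rewrite in_setU NI !inE opprK groupV -andb_orr.
    by rewrite leq_total andbT.
  apply: eq_card => x; rewrite in_setI NI [in RHS]inE !(inE, opprK) groupV.
  rewrite andbACA andbb -eqn_leq mulr2n addr_eq0; congr (_ && _).
  by apply/eqP/eqP=> [/val_inj/enum_rank_inj | <-].
rewrite -cardS; congr (2 * _)%N; apply: bigmax_card_eq => // S' /cliqueP cliS'.
rewrite -(leq_pmul2l (m := 2)) // cardS.
have [->|[z S'z]] := set_0Vmem S'; first by rewrite cards0.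
have sS' : S' \subset (H :* z)%g.
  apply/subsetP=> y S'y; have [->|neq_yz] := eqVneq y z; first exact: rcoset_refl.
  rewrite mem_rcoset_doubles; have /andP[_] := cliS' y z S'y S'z neq_yz.
  by case/setD1P.
rewrite mul2n -addnn -{2}(cardN S') -(cardsUI S').
rewrite -[X in (_ <= X + _)%N](card_rcoset (doubles G) z).
apply: leq_add; last apply: leq_trans (card_rcosetI_torsion2 z).
  apply/subset_leq_card; rewrite subUset sS'; apply/subsetP=> x.
  by rewrite NI -(oppr_rcoset_doubles x) => /(subsetP sS').
apply/subset_leq_card/subsetP=> x /setIP[S'x]; rewrite NI => S'Nx.
rewrite inE (subsetP sS') //=; apply/torsion2P/eqP/negPn/negP=> neq_x.
by have /andP[_] := cliS' _ _ S'x S'Nx neq_x; rewrite subrr !inE eqxx.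
Qed.

(** In a coset, the only non-neighbour of x other than x itself is -x. *)
Lemma independence_sum_graph_coset (C : {set G}) : C \in P ->
  independence_in (sum_graph H) C = if C \subset torsion G 2 then 1%N else 2.
Proof.
case/rcosetsP=> c _ ->.
(* An independent set inside a coset is contained in some {x, -x}. *)
have indC (S : {set G}) : independent (sum_graph H) S -> S \subset (H :* c)%g ->
    {in S, forall x, S \subset [set x; - x]}.
  move=> /independentP indS /subsetP sS x Sx; apply/subsetP=> y Sy.
  rewrite !inE -implyNb; apply/implyP=> neq_yx.
  have := indS y x Sy Sx neq_yx; rewrite /sum_graph neq_yx !inE /=.
  by rewrite (rcoset_doublesD (sS y Sy) (sS x Sx)) andbT negbK addr_eq0.
case: ifPn => [sC | /subsetPn[x Cx tx]].
  rewrite -(cards1 c); apply: bigmax_card_eq => [|S /andP[indS sS]].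
    by rewrite independent1 sub1set rcoset_refl.
  have [->|[x Sx]] := set_0Vmem S; first by rewrite cards0.
  have /torsion2P defx := subsetP sC x (subsetP sS x Sx).
  rewrite cards1 -(cards1 x) subset_leq_card //.
  by have := indC S indS sS x Sx; rewrite -defx setUid.
have neq_x : x != - x by apply: contraNneq tx => /torsion2P.
have card2 : #|[set x; - x]| = 2 by rewrite cards2 neq_x.
rewrite -card2; apply: bigmax_card_eq => [|S /andP[indS sS]].
  apply/andP; split; last by rewrite subUset !sub1set oppr_rcoset_doubles Cx.
  apply/independentP=> y z /set2P[]-> /set2P[]->; rewrite ?eqxx //.
    by rewrite /sum_graph subrr !inE eqxx andbF.
  by rewrite /sum_graph addNr !inE eqxx andbF.
have [->|[y Sy]] := set_0Vmem S; first by rewrite cards0.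
rewrite card2 (leq_trans (subset_leq_card (indC S indS sS y Sy))) //.
by rewrite cards2; case: (_ != _).
Qed.

(** The correction term counts the cosets of 2G contained in G[2]. *)
Lemma independence_number_sum_graph :
  independence_number (sum_graph H) =
    (2 * #|torsion G 2| -
     (if torsion G 4 == setT then #|torsion G 2 : H|%g else 0))%N.
Proof.
rewrite (independence_number_partition rcosets_doubles_partition); last first.
  by move=> x y /andP[_] /setD1P[_]; apply: pblock_doubles_eq.
have -> : (if torsion G 4 == setT then #|torsion G 2 : H|%g else 0%N) =
    (\sum_(C in P) (C \subset torsion G 2))%N.
  rewrite -doubles_sub_torsion2; case: ifPn => [sH | nsH].
    rewrite -big_mkcondr sum1dep_card; apply: eq_card => C; rewrite !inE.
    apply/rcosetsP/andP=> [[x tx ->] | [/rcosetsP[x _ ->] sC]].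
      split; first by apply/rcosetsP; exists x; rewrite ?inE.
      by rewrite -(rcoset_id (tx : x \in torsion_group G 2)) mulSg.
    by exists x => //; apply: (subsetP sC); apply: rcoset_refl.
  rewrite big1 // => _ /rcosetsP[x _ ->]; case: subsetP => // sC.
  case/subsetP: nsH => y Hy; have tx := sC x (rcoset_refl H x).
  have := sC (y * x)%g; rewrite mem_rcoset mulgK => /(_ Hy).
  by rewrite groupMr.
rewrite -card_rcosets_doubles mulnC -sum_nat_const -sumnB => [|C _]; last first.
  by case: (_ \subset _).
by apply: eq_bigr => C PC; rewrite independence_sum_graph_coset //; case: ifP.
Qed.

End SumGraphsOfDoubles.

(** * Torsion and cyclic decompositions *)

Section Decomposition.

Variables (G : finZmodType) (A B : {group G}).
Hypothesis hAB : (A \x B)%g = [set: G].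
Hypothesis hA : odd #|A|.
Hypothesis hB : (2.-group B)%g.

(** The 2-power torsion of G lies in its Hall subgroup B. *)
Lemma torsion_Ohm n : torsion G (2 ^ n) = 'Ohm_n(B)%g.
Proof.
rewrite (OhmEabelian hB) ?zmod_abelian //.
have [_ defG _ _] := dprodP hAB.
have hallB : (2.-Hall([set: G]) B)%g.
  have [|//] := coprime_mulGp_Hall (G := [group of [set: G]]) defG _ hB.
  by rewrite /pgroup -odd_2'nat.
have nsB : (B <| [set: G])%g by rewrite -sub_abelian_normal ?zmod_abelian ?subsetT.
apply/setP=> x; rewrite !inE zmodXgE andb_idl // => tx.
rewrite (mem_normal_Hall hallB nsB) ?inE //.
by rewrite /p_elt (pnat_dvd (n := 2 ^ n)) ?order_dvdn ?zmodXgE // pnatX pnat_id.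
Qed.

Variable b : seq G.
Hypothesis hb : cyclic_decomposition B b.
Hypothesis hb1 : all (fun x : G => 1 < #[x]%g)%N b.

Lemma mem_decomposition x : x \in b -> x \in B.
Proof.
move=> bx; have := hb; rewrite /cyclic_decomposition (big_rem x bx) /=.
case/dprodP=> [[_ K _ defK] <- _ _].
by rewrite -[x in x \in _]mulg1 mem_mulg ?cycle_id ?defK.
Qed.

(** The orders of the members of the decomposition are powers of 2 larger than
    1. *)
Lemma order_decomposition x :
  x \in b -> exists n, #[x]%g = (2 ^ n.+1)%N.
Proof.
move=> bx; have /p_natP[[|n] ox] := mem_p_elt hB (mem_decomposition bx).
  by have := allP hb1 x bx; rewrite ox.
by exists n.
Qed.

Lemma card_Ohm_index n :
  #|'Ohm_n.+1(B) : 'Ohm_n(B)|%g =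
  (2 ^ count [pred x | (n < logn 2 #[x]%g)%N] b)%N.
Proof.
rewrite (count_logn_dprod_cycle 2 n hb) -p_part part_pnat_id //.
apply: pnat_dvd (dvdn_indexg _ _) _.
exact: pgroupS (Ohm_sub _ _) hB.
Qed.

Lemma card_torsion2 : #|torsion G 2| = (2 ^ size b)%N.
Proof.
have := card_Ohm_index 0; rewrite Ohm0 indexg1 (torsion_Ohm 1) => ->.
congr (2 ^ _)%N; apply/eqP; rewrite -all_count; apply/allP=> x bx /=.
by have [n ->] := order_decomposition bx; rewrite pfactorK.
Qed.

Lemma card_doubles_torsion2 :
  #|doubles G :&: torsion G 2| =
  (2 ^ (size b - count (fun x : G => #[x]%g == 2%N) b))%N.
Proof.
apply/eqP; rewrite -(eqn_pmul2r (cardG_gt0 (torsion_group G 2))) card_doublesI.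
rewrite -(Lagrange (torsion2_sub_torsion4 G)) mulnC eqn_pmul2r ?cardG_gt0 //.
rewrite /= (torsion_Ohm 1) (torsion_Ohm 2) card_Ohm_index.
rewrite -(count_predC (fun x : G => #[x]%g == 2%N) b) addKn.
apply/eqP; congr (2 ^ _)%N; apply: eq_in_count => x bx /=.
have [n ->] := order_decomposition bx.
by rewrite pfactorK // (@eqn_exp2l 2 _ 1); case: n.
Qed.

Lemma product_of_cyclic_2_4_torsion :
  product_of_cyclic_2_4 G <-> torsion G 4 = [set: G].
Proof.
split=> [[c [defG oc]] | t4].
  suffices sub4 (X : {group G}) :
      \big[dprod/1%g]_(y <- c) <[y]>%g = X -> X \subset torsion G 4.
    by apply/eqP; rewrite -subTset (sub4 [group of [set: G]]).
  elim: c oc X {defG} => [_ X|y c IHc /= /andP[oy /IHc{}IHc] X].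
    by rewrite big_nil => <-; apply: sub1G.
  rewrite big_cons => /dprodP[[_ K _ defK] <- _ _].
  rewrite defK mulG_subG (IHc K defK) andbT cycle_subG inE -zmodXgE -zmod1gE.
  by rewrite -order_dvdn; case/orP: oy => /eqP->.
have defB : B :=: [set: G].
  by apply/eqP; rewrite -subTset -t4 (torsion_Ohm 2) Ohm_sub.
exists b; split; first by rewrite -defB.
apply/allP=> x bx; have [n ox] := order_decomposition bx.
have : x \in torsion G 4 by rewrite t4 inE.
rewrite inE -zmodXgE -zmod1gE -order_dvdn ox (dvdn_Pexp2l (p := 2) _ 2) //.
by case: n {ox} => [|[|n]].
Qed.

End Decomposition.

Theorem mainTheorem7 (G : finZmodType) (A B : {group G})
    (hAB : (A \x B)%g = [set: G])
    (hA : odd #|A|)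
    (hB : (2.-group B)%g) (hB1 : B :!=: 1%g)
    (h2G : doubles G != [set 0])
    (r q : nat) (b : seq G)
    (hb : cyclic_decomposition B b)
    (hb1 : all (fun x : G => 1 < #[x]%g)%N b)
    (hr : size b = r)
    (hq : count (fun x : G => #[x]%g == 2%N) b = q)
    (k : nat) (hk : k = #|doubles G|) :
  (k * 2 ^ r)%N = #|G| /\
  (clique_number (sum_graph_plus (doubles_group G)) = k /\
   independence_number (sum_graph_plus (doubles_group G)) = (2 ^ r)%N) /\
  ((2 * clique_number (sum_graph (doubles_group G)))%N
     = (k + 2 ^ (r - q))%N /\
   (~ product_of_cyclic_2_4 G ->
    independence_number (sum_graph (doubles_group G)) = (2 ^ r.+1)%N) /\
   (product_of_cyclic_2_4 G ->
    independence_number (sum_graph (doubles_group G))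
      = (2 ^ r.+1 - 2 ^ q)%N)).
Proof.
have cardT2 := card_torsion2 hAB hA hB hb hb1.
have cardHT2 := card_doubles_torsion2 hAB hA hB hb hb1.
have torsion4P := product_of_cyclic_2_4_torsion hAB hA hB hb hb1.
rewrite hr in cardT2; rewrite hr hq in cardHT2; subst k.
split; first by rewrite -cardT2 card_doubles.
split; first split.
- exact: clique_number_sum_graph_plus.
- by rewrite independence_number_sum_graph_plus.
split; first by rewrite double_clique_number_sum_graph cardHT2.
rewrite independence_number_sum_graph cardT2 expnS.
split=> [/torsion4P/eqP/negPf-> | /torsion4P t4]; first by rewrite subn0.
rewrite t4 eqxx; congr (_ - _)%N.
have sHT2 : doubles_group G \subset torsion_group G 2.
  by rewrite doubles_sub_torsion2 t4.
have q_le_r : (q <= r)%N by rewrite -hr -hq count_size.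
apply/eqP; rewrite -(eqn_pmul2l (cardG_gt0 (doubles_group G))).
rewrite (Lagrange sHT2) [#|torsion_group G 2|]cardT2.
by rewrite -[doubles_group G : {set G}](setIidPl sHT2) cardHT2 -expnD subnK.
Qed.
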